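(* Let $1\le i\le n$ be integers. The fixed interval vector polytope $\mathcal{P}_n(\mathcal{I}_i)\subset\mathbb{R}^n$, i.e. the convex hull of the vectors $\alpha_{k,k+i-1}=e_k+e_{k+1}+\dots+e_{k+i-1}$ for $1\le k\le n-i+1$, is an $(n-i)$-dimensional unimodular simplex.
   Context: Here $e_k$ denotes the $k$-th standard unit vector of $\mathbb{R}^n$. The vectors $\alpha_{k,k+i-1}$ are exactly the $(0,1)$-vectors in $\mathbb{R}^n$ having exactly $i$ ones, all of which appear consecutively (interval vectors of interval length $i$). A $d$-dimensional polytope is a $d$-simplex if it has $d+1$ vertices. A unimodular simplex in $\mathbb{R}^n$ is a lattice simplex $\Delta$ (vertices in $\mathbb{Z}^n$) whose edge directions at any vertex $v$ (the vectors $w-v$ for the other vertices $w$) form a lattice basis for $\mathbb{Z}^n\cap\operatorname{aff}(\Delta)$, where $\operatorname{aff}(\Delta)$ is the affine hull of $\Delta$; that is, every point of $\mathbb{Z}^n\cap\operatorname{aff}(\Delta)$ is $v$ plus a unique integer linear combination of these edge directions. *)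

(* Defs.v *)
From mathcomp Require Import all_boot all_order all_algebra.
From mathcomp Require Import all_classical reals.

Set Implicit Arguments.
Unset Strict Implicit.
Unset Printing Implicit Defensive.

Import Order.TTheory GRing.Theory Num.Theory.

Local Open Scope classical_set_scope.
Local Open Scope ring_scope.

(* Points of R^n are row vectors. *)

Definition convex_hull (R : realType) (n : nat) (A : set 'rV[R]_n) :
    set 'rV[R]_n :=
  [set x | exists (m : nat) (p : 'I_m -> 'rV[R]_n) (c : 'I_m -> R),
    [/\ forall k, A (p k), forall k, 0 <= c k, \sum_k c k = 1
      & x = \sum_k c k *: p k]].

Definition affine_hull (R : realType) (n : nat) (A : set 'rV[R]_n) :
    set 'rV[R]_n :=
  [set x | exists (m : nat) (p : 'I_m -> 'rV[R]_n) (c : 'I_m -> R),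
    [/\ forall k, A (p k), \sum_k c k = 1 & x = \sum_k c k *: p k]].

Definition polytope (R : realType) (n : nat) (P : set 'rV[R]_n) : Prop :=
  exists2 A : set 'rV[R]_n, finite_set A & P = convex_hull A.

(* The dimension of a set is that of its affine hull, i.e. of the linear
   subspace W of which the affine hull is a translate; no dimension is assigned
   to the empty set. *)
Definition has_dimension (R : realType) (n : nat) (P : set 'rV[R]_n)
    (d : nat) : Prop :=
  exists (p : 'rV[R]_n) (W : {vspace 'rV[R]_n}),
    affine_hull P = [set x | x - p \in W] /\ \dim W = d.

(* A face is cut out by a valid linear inequality <a, x> <= b; the choice a = 0
   is allowed, so P itself is a face. *)
Definition face (R : realType) (n : nat) (P F : set 'rV[R]_n) : Prop :=
  exists (a : 'rV[R]_n) (b : R),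
    (forall x, P x -> \sum_j a 0 j * x 0 j <= b) /\
    F = P `&` [set x | \sum_j a 0 j * x 0 j = b].

(* The vertices are the 0-dimensional faces. *)
Definition vertices (R : realType) (n : nat) (P : set 'rV[R]_n) :
    set 'rV[R]_n :=
  [set v | face P [set v]].

Definition simplex (R : realType) (n : nat) (d : nat) (P : set 'rV[R]_n) :
    Prop :=
  [/\ polytope P, has_dimension P d & (vertices P #= `I_d.+1)%card].

Definition lattice_point (R : realType) (n : nat) (x : 'rV[R]_n) : Prop :=
  forall j, x 0 j \is a Num.int.

(* The integer coefficients on the edge directions w - v are encoded as a
   function on all of R^n that vanishes away from the other vertices w, so that
   uniqueness of the function is uniqueness of the coefficients. *)
Definition unimodular_simplex (R : realType) (n : nat) (d : nat)
    (P : set 'rV[R]_n) : Prop :=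
  [/\ simplex d P,
      forall v, vertices P v -> lattice_point v
    & forall v, vertices P v ->
      forall x, affine_hull P x -> lattice_point x ->
      exists! c : 'rV[R]_n -> int,
        (forall w, ~ (vertices P `\ v) w -> c w = 0) /\
        x = v + \sum_(w \in vertices P `\ v) (w - v) *~ c w].

(* alpha_{k,l} = e_k + ... + e_l with coordinates numbered from 1, whereas
   j : 'I_n is numbered from 0. *)
Definition interval_vector (R : realType) (n k l : nat) : 'rV[R]_n :=
  \sum_(j < n | (k <= j.+1 <= l)%N) delta_mx 0 j.

Definition fixed_interval_polytope (R : realType) (n i : nat) :
    set 'rV[R]_n :=
  convex_hull [set interval_vector R n k (k + i - 1) |
                 k in [set k : nat | (1 <= k <= n - i + 1)%N]].
Arguments fixed_interval_polytope : clear implicits.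

(* Main.v *)
Require Import Defs.
From HB Require Import structures.
From mathcomp Require Import all_boot all_order all_algebra.
From mathcomp Require Import all_classical reals.
From mathcomp Require Import zify ring lra.

(** A family of lattice points [a 0, ..., a d] with lattice vectors [f k] such
    that [<f k, a l> = (k == l)] spans a unimodular simplex: on the affine hull
    the functionals [<f k, _>] are the barycentric coordinates, and they take
    integer values at lattice points. For the interval vectors of length [i],
    numbered from 0, [<e_k - e_(k-1), a l> = (k == l) - (k == l + i)], so the
    dual family is given by the recursion [f k = e_k - e_(k-1) + f (k-i)]. *)

Set Implicit Arguments.
Unset Strict Implicit.
Unset Printing Implicit Defensive.

Import Order.TTheory GRing.Theory Num.Theory.

Local Open Scope classical_set_scope.
Local Open Scope ring_scope.

(** * The standard pairing on row vectors *)

Definition dot (R : realType) (n : nat) (f x : 'rV[R]_n) : R :=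
  \sum_j f 0 j * x 0 j.

Lemma dot_is_scalar (R : realType) (n : nat) (f : 'rV[R]_n) : scalar (dot f).
Proof.
move=> c x y; rewrite /dot mulr_sumr -big_split /=.
by apply: eq_bigr => j _; rewrite !mxE; ring.
Qed.

HB.instance Definition _ (R : realType) (n : nat) (f : 'rV[R]_n) :=
  GRing.isLinear.Build R 'rV[R]_n R *%R (dot f) (@dot_is_scalar R n f).

Lemma dotDl (R : realType) (n : nat) (f g x : 'rV[R]_n) :
  dot (f + g) x = dot f x + dot g x.
Proof.
by rewrite /dot -big_split; apply: eq_bigr => j _; rewrite mxE mulrDl.
Qed.

Lemma dotNl (R : realType) (n : nat) (f x : 'rV[R]_n) :
  dot (- f) x = - dot f x.
Proof. by rewrite /dot -sumrN; apply: eq_bigr => j _; rewrite mxE mulNr. Qed.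

Lemma dot_delta (R : realType) (n : nat) (j : 'I_n) (x : 'rV[R]_n) :
  dot (delta_mx 0 j) x = x 0 j.
Proof.
rewrite /dot (bigD1 j) //= big1 ?addr0 => [|l lj].
  by rewrite mxE !eqxx mul1r.
by rewrite mxE (negPf lj) andbF mul0r.
Qed.

Lemma dot_int (R : realType) (n : nat) (f x : 'rV[R]_n) :
  lattice_point f -> lattice_point x -> dot f x \is a Num.int.
Proof. by move=> fZ xZ; apply: rpred_sum => j _; apply: rpredM. Qed.

Lemma dot_sumZ (R : realType) (n m : nat) (f : 'rV[R]_n) (c : 'I_m -> R)
    (p : 'I_m -> 'rV[R]_n) :
  dot f (\sum_j c j *: p j) = \sum_j c j * dot f (p j).
Proof. by rewrite linear_sum; apply: eq_bigr => j _; rewrite linearZ. Qed.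

(** * Dual families and barycentric coordinates *)

Definition dual_family (R : realType) (n m : nat) (a f : 'I_m -> 'rV[R]_n) :=
  forall k l, dot (f k) (a l) = (k == l)%:R.

Lemma dot_dual_sum (R : realType) (n m : nat) (a f : 'I_m -> 'rV[R]_n)
    (c : 'I_m -> R) (k : 'I_m) :
  dual_family a f -> dot (f k) (\sum_l c l *: a l) = c k.
Proof.
move=> fa; rewrite dot_sumZ (bigD1 k) //= big1 => [|l lk].
  by rewrite fa eqxx mulr1 addr0.
by rewrite fa eq_sym (negPf lk) mulr0.
Qed.

Lemma dual_inj (R : realType) (n m : nat) (a f : 'I_m -> 'rV[R]_n) :
  dual_family a f -> injective a.
Proof.
move=> fa k l akl; have := fa k l; rewrite -akl fa eqxx.
by case: eqP => // _ /eqP; rewrite oner_eq0.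
Qed.

(** For a dual family this is membership in the affine hull of the [a k], with the coefficients read
    off from [x] instead of quantified existentially. *)
Definition affine_coords (R : realType) (n m : nat) (a f : 'I_m -> 'rV[R]_n)
    (x : 'rV[R]_n) : Prop :=
  x = \sum_k dot (f k) x *: a k /\ \sum_k dot (f k) x = 1.

Lemma affine_coords_dual (R : realType) (n m : nat) (a f : 'I_m -> 'rV[R]_n)
    (c : 'I_m -> R) :
  dual_family a f -> \sum_k c k = 1 -> affine_coords a f (\sum_k c k *: a k).
Proof.
move=> fa c1; split; last by under eq_bigr do rewrite dot_dual_sum //.
by apply: eq_bigr => k _; rewrite dot_dual_sum.
Qed.

Lemma affine_coords_point (R : realType) (n m : nat) (a f : 'I_m -> 'rV[R]_n)
    (k : 'I_m) :
  dual_family a f -> affine_coords a f (a k).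
Proof.
move=> fa.
have -> : a k = \sum_l (l == k)%:R *: a l.
  rewrite (bigD1 k) //= big1 ?eqxx ?scale1r ?addr0 // => l /negPf ->.
  by rewrite scale0r.
apply: affine_coords_dual => //.
by rewrite (bigD1 k) //= big1 ?eqxx ?addr0 // => l /negPf ->.
Qed.

(** The first condition is linear in the point and the second is affine, so both survive
    combinations of total weight 1. *)
Lemma affine_coords_comb (R : realType) (n m r : nat) (a f : 'I_m -> 'rV[R]_n)
    (p : 'I_r -> 'rV[R]_n) (c : 'I_r -> R) :
  (forall j, affine_coords a f (p j)) -> \sum_j c j = 1 ->
  affine_coords a f (\sum_j c j *: p j).
Proof.
move=> pa c1; split.
  rewrite (eq_bigr (fun k => \sum_j (c j * dot (f k) (p j)) *: a k)); last first.
    by move=> k _; rewrite dot_sumZ scaler_suml.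
  rewrite exchange_big; apply: eq_bigr => j _.
  rewrite {1}(pa j).1 scaler_sumr.
  by apply: eq_bigr => k _; rewrite scalerA.
under eq_bigr do rewrite dot_sumZ.
rewrite exchange_big /= -c1; apply: eq_bigr => j _.
by rewrite -mulr_sumr (pa j).2 mulr1.
Qed.

(** * Hulls, vertices and dimension of the spanned simplex *)

Lemma convex_hull_range (R : realType) (n m : nat) (a f : 'I_m -> 'rV[R]_n) :
  dual_family a f ->
  convex_hull (range a) =
    [set x | affine_coords a f x /\ forall k, 0 <= dot (f k) x].
Proof.
move=> fa; apply/seteqP; split=> [_ [r [p [c [pa c0 c1 ->]]]]|x [[xE x1] x0]].
  split.
    by apply: affine_coords_comb => // j; have [k _ <-] := pa j;
      apply: affine_coords_point.
  move=> k; rewrite dot_sumZ; apply: sumr_ge0 => j _; apply: mulr_ge0 => //.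
  by have [l _ <-] := pa j; rewrite fa ler0n.
by exists m, a, (fun k => dot (f k) x); split => // k; exists k.
Qed.

Lemma convex_hull_sub (R : realType) (n : nat) (A : set 'rV[R]_n) :
  A `<=` convex_hull A.
Proof.
move=> x Ax; exists 1, (fun=> x), (fun=> 1).
by split=> //; rewrite big_ord1 ?scale1r.
Qed.

Lemma affine_hull_range (R : realType) (n m : nat) (a f : 'I_m -> 'rV[R]_n) :
  dual_family a f ->
  affine_hull (convex_hull (range a)) = [set x | affine_coords a f x].
Proof.
move=> fa; apply/seteqP; split=> [_ [r [p [c [pa c1 ->]]]]|x [xE x1]].
  apply: affine_coords_comb => // j.
  by have := pa j; rewrite (convex_hull_range fa) => -[].
exists m, a, (fun k => dot (f k) x); split => // k.
by apply: convex_hull_sub; exists k.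
Qed.

(** A valid inequality that is tight at [v] is tight at every [a k] on which [v] has positive
    weight; if it cuts out [v] alone, then [v] is that [a k]. *)
Lemma vertices_range (R : realType) (n m : nat) (a f : 'I_m -> 'rV[R]_n) :
  dual_family a f -> vertices (convex_hull (range a)) = range a.
Proof.
move=> fa; apply/seteqP; split=> [v [g [b [gb vE]]]|_ [k _ <-]].
  have [vP vb] : (convex_hull (range a) `&`
      [set x | \sum_j g 0 j * x 0 j = b]) v by rewrite -vE.
  have aP l : convex_hull (range a) (a l) by apply: convex_hull_sub; exists l.
  move: (vP); rewrite (convex_hull_range fa) => -[[vS v1] v0].
  (* The slack at [v], which is 0, is the weighted mean of the slacks at the [a k]; all terms are
     nonnegative, so each vanishes. *)
  have sum0 : \sum_k dot (f k) v * (b - dot g (a k)) = 0.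
    under eq_bigr do rewrite mulrBr.
    rewrite big_split /= -mulr_suml v1 mul1r sumrN -dot_sumZ -vS.
    by rewrite -{1}vb subrr.
  have [k fk0] : exists k, dot (f k) v != 0.
    apply/existsP; apply: contraT; rewrite negb_exists => /forallP H.
    move: v1; rewrite big1 => [/eqP|k _]; first by rewrite eq_sym oner_eq0.
    by apply/eqP; rewrite -[_ == _]negbK.
  have /eqP : dot (f k) v * (b - dot g (a k)) = 0.
    have pos l : true -> 0 <= dot (f l) v * (b - dot g (a l)).
      by move=> _; rewrite mulr_ge0 // subr_ge0 gb.
    exact: (psumr_eq0P pos sum0).
  rewrite mulf_eq0 (negPf fk0) /= subr_eq0 => /eqP bE.
  have : [set v] (a k) by rewrite vE; split => //=; rewrite bE.
  by move=> /= akv; exists k.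
(* A barycentric coordinate is at most 1 on the hull, and it equals 1 only where all the others
   vanish. *)
exists (f k), 1; split=> [x|].
  rewrite (convex_hull_range fa) => -[[_ x1] x0].
  by rewrite -x1 (bigD1 k) //= lerDl sumr_ge0.
apply/seteqP; split=> [_ -> |x] /=.
  split; first by apply: convex_hull_sub; exists k.
  by rewrite -/(dot _ _) fa eqxx.
rewrite (convex_hull_range fa) -/(dot _ _) => -[[[xE x1] x0] fk].
have fl0 l : l != k -> dot (f l) x = 0.
  move: x1; rewrite (bigD1 k) //= fk => /eqP.
  rewrite -subr_eq0 addrC addrK => /eqP s0.
  by apply: (psumr_eq0P _ s0).
rewrite xE (bigD1 k) //= big1 ?fk ?scale1r ?addr0 // => l /fl0 ->.
by rewrite scale0r.
Qed.

(** The direction space is spanned by the edges at [a ord0], which are free because the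
    [f (lift ord0 l)] are dual to them. *)
Lemma has_dimension_range (R : realType) (n d : nat)
    (a f : 'I_d.+1 -> 'rV[R]_n) :
  dual_family a f -> has_dimension (convex_hull (range a)) d.
Proof.
move=> fa.
have [e eE] : exists e : d.-tuple 'rV[R]_n,
    forall k : 'I_d, e`_k = a (lift ord0 k) - a ord0.
  by exists [tuple a (lift ord0 k) - a ord0 | k < d] => k; rewrite nth_mktuple.
have dot_e (l k : 'I_d) : dot (f (lift ord0 l)) e`_k = (l == k)%:R.
  by rewrite eE raddfB /= !fa (inj_eq lift_inj) subr0.
exists (a ord0), <<e>>%VS; split.
  rewrite (affine_hull_range fa); apply/seteqP; split=> x /=.
    move=> [xE x1].
    (* As the coordinates sum to 1, the one at [a ord0] can be eliminated. *)
    have -> : x - a ord0 = \sum_(k < d) dot (f (lift ord0 k)) x *: e`_k.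
      rewrite {1}xE big_ord_recl -[X in _ - X]scale1r -x1 big_ord_recl.
      rewrite scalerDl opprD addrACA subrr add0r scaler_suml -sumrB.
      by apply: eq_bigr => k _; rewrite eE scalerBr.
    apply: rpred_sum => k _; apply/rpredZ/memv_span.
    by apply: mem_nth; rewrite size_tuple.
  move=> /coord_span xW; pose c k := coord e k (x - a ord0).
  have xE : x = \sum_k c k *: a (lift ord0 k) + (1 - \sum_k c k) *: a ord0.
    rewrite -[LHS](subrK (a ord0)) [in LHS]xW scalerBl scale1r scaler_suml.
    rewrite addrCA [RHS]addrC -sumrB; congr (_ + _).
    by apply: eq_bigr => k _; rewrite eE scalerBr.
  (* [a ord0] receives the weight that brings the total to 1. *)
  pose c' k := if unlift ord0 k is Some l then c l else 1 - \sum_l c l.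
  have c'0 : c' ord0 = 1 - \sum_l c l by rewrite /c' unlift_none.
  have c'l l : c' (lift ord0 l) = c l by rewrite /c' liftK.
  have -> : x = \sum_k c' k *: a k.
    rewrite big_ord_recl; under [in RHS]eq_bigr do rewrite c'l.
    by rewrite c'0 addrC.
  apply: affine_coords_dual => //.
  by rewrite big_ord_recl; under eq_bigr do rewrite c'l; rewrite c'0 subrK.
suff /eqP -> : free e by rewrite size_tuple.
apply/freeP => c c0 l.
have := congr1 (dot (f (lift ord0 l))) c0; rewrite raddf0 dot_sumZ.
rewrite (bigD1 l) //= big1 => [|k kl]; first by rewrite dot_e eqxx mulr1 addr0.
by rewrite dot_e eq_sym (negPf kl) mulr0.
Qed.

Lemma simplex_range (R : realType) (n d : nat) (a f : 'I_d.+1 -> 'rV[R]_n) :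
  dual_family a f -> simplex d (convex_hull (range a)).
Proof.
move=> fa; split; first by exists (range a) => //; apply/finite_image/finite_finset.
  exact: has_dimension_range fa.
rewrite (vertices_range fa).
apply: card_eq_trans (_ : [set: 'I_d.+1] #= `I_d.+1)%card.
  by apply: inj_card_eq => k l _ _; apply: dual_inj fa k l.
by rewrite card_eq_sym; exact: card_II.
Qed.

(** The coefficient of the edge from [a k] to [a l] must be [dot (f l) x]: pairing with [f l] kills
    [a k] and every other edge. *)
Lemma unimodular_range (R : realType) (n d : nat) (a f : 'I_d.+1 -> 'rV[R]_n) :
  dual_family a f -> (forall k, lattice_point (a k)) ->
  (forall k, lattice_point (f k)) ->
  unimodular_simplex d (convex_hull (range a)).
Proof.
move=> fa aZ fZ; split; first exact: simplex_range fa.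
  by rewrite (vertices_range fa) => _ [k _ <-].
rewrite (vertices_range fa) (affine_hull_range fa) => _ [k _ <-] x [xE x1] xZ.
have a_inj := dual_inj fa.
(* Injectivity of [a] turns the sum over vertices into a sum over indices. *)
have sumE (b : 'rV[R]_n -> int) :
    \sum_(w \in range a `\ a k) (w - a k) *~ b w =
    \sum_(l | l != k) (b (a l))%:~R *: (a l - a k).
  have -> : range a `\ a k = a @` [set` [pred l | l != k]].
    apply/seteqP; split=> [_ [[l _ <-] lk]|_ [l /= lk <-]].
      by exists l => //=; apply: contra_notN lk => /eqP ->.
    by split; [exists l | move=> /= /a_inj /eqP; rewrite (negPf lk)].
  rewrite fsbig_image; last by move=> ? ? _ _; apply: a_inj.
  rewrite -(@bigfs _ _ _ _ (index_enum _)) ?index_enum_uniq //.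
    by apply: eq_bigr => l _; rewrite scaler_int.
  by move=> l _; rewrite mem_index_enum.
(* At most one term occurs, and none away from the other vertices, where [c] must be 0. The floor
   only converts an integral real to [int]. *)
pose c w := \sum_(l | (l != k) && (a l == w)) Num.floor (dot (f l) x).
have c0 w : ~ (range a `\ a k) w -> c w = 0.
  move=> wn; apply: big_pred0 => l; apply/negP => /andP[lk /eqP alw]; apply: wn.
  rewrite -alw; split; first by exists l.
  by move=> /= /a_inj /eqP; rewrite (negPf lk).
have cE l : l != k -> c (a l) = Num.floor (dot (f l) x).
  move=> lk; rewrite /c (big_pred1 l) => [//|l' /=].
  by rewrite (inj_eq a_inj); case: (eqVneq l' l) => [->|]; rewrite ?andbT ?andbF.
exists c; split=> [|c' [c'0 c'E]].
  split=> //; rewrite sumE.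
  rewrite (eq_bigr (fun l => dot (f l) x *: a l - dot (f l) x *: a k)).
    rewrite sumrB -scaler_suml {1}xE (bigD1 k) //=.
    move: x1; rewrite (bigD1 k) //= => /(canRL (addrK _)) ->.
    by rewrite scalerBl scale1r -addrA [- _ + _]addrC.
  by move=> l lk; rewrite cE // floorK ?scalerBr //; apply: dot_int.
apply/funext => w.
have [[[l _ <-] lk]|wn] := pselect ((range a `\ a k) w); last first.
  by rewrite c'0 // c0.
have {}lk : l != k by apply: contra_notN lk => /eqP ->.
rewrite cE //; suff -> : dot (f l) x = (c' (a l))%:~R by rewrite intrKfloor.
rewrite c'E sumE raddfD /= fa (negPf lk) add0r raddf_sum /= (bigD1 l) //=.
rewrite big1 => [|j /andP[_ jl]]; rewrite linearZ /= raddfB /= !fa (negPf lk).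
  by rewrite eqxx subr0 mulr1 addr0.
by rewrite eq_sym (negPf jl) subr0 mulr0.
Qed.

(** * Interval vectors and their dual family *)

Lemma interval_vectorE (R : realType) (n k l : nat) (j : 'I_n) :
  interval_vector R n k l 0 j = (k <= j.+1 <= l)%N%:R.
Proof.
rewrite summxE; case: (boolP (k <= j.+1 <= l)%N) => H.
  rewrite (bigD1 j) //= big1 ?addr0 ?mxE ?eqxx // => s /andP[_ sj].
  by rewrite mxE eq_sym (negPf sj).
apply: big1 => s Hs; rewrite mxE; case: (eqVneq j s) => [js|_]; last first.
  by rewrite andbF.
by move: H; rewrite js Hs.
Qed.

Lemma interval_vector_dual (R : realType) (n i k : nat) :
  (0 < i)%N -> (k < n)%N ->
  exists2 f : 'rV[R]_n, lattice_point f &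
    forall l : nat, dot f (interval_vector R n l.+1 (l + i)) = (k == l)%:R.
Proof.
move=> i0; have deltaZ (j : 'I_n) : lattice_point (delta_mx 0 j : 'rV[R]_n).
  by move=> s; rewrite mxE; case: (_ && _).
elim/ltn_ind: k => -[|k] IH kn.
  (* Among the intervals, only the one with [l = 0] covers the first coordinate. *)
  exists (delta_mx 0 (Ordinal kn)) => // l.
  by rewrite dot_delta interval_vectorE /=; congr (_%:R); lia.
pose g : 'rV[R]_n :=
  delta_mx 0 (Ordinal kn) - delta_mx 0 (Ordinal (ltnW kn)).
have gZ : lattice_point g.
  by move=> j; rewrite mxE [in X in _ + X]mxE; apply: rpredB; apply: deltaZ.
have gE l : dot g (interval_vector R n l.+1 (l + i)) =
    (k.+1 == l)%:R - (k.+1 == l + i)%N%:R.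
  rewrite dotDl dotNl !dot_delta !interval_vectorE /=.
  (* Between two neighbouring coordinates an interval either starts, or ends, or does not change.
     The terms are arranged to avoid truncated subtraction. *)
  have : ((l < k.+2 <= l + i) + (k.+1 == l + i) =
      (l < k.+1 <= l + i) + (k.+1 == l))%N by lia.
  by move=> /(congr1 (fun m => m%:R : R)); rewrite !natrD; lra.
(* If [k.+1 < i], no interval ends just before coordinate [k.+1], so [g] is already dual; otherwise
   the functional of index [k.+1 - i] cancels the end term. *)
have [ki|ik] := ltnP k.+1 i.
  exists g => // l; rewrite gE (_ : (k.+1 == l + i)%N = false) ?subr0 //; lia.
have [||f fZ fE] := IH (k.+1 - i)%N; [lia|lia|].
exists (g + f) => [j|l]; first by rewrite mxE; apply: rpredD.
rewrite dotDl gE fE (_ : (k.+1 - i == l)%N = (k.+1 == l + i)%N) ?subrK //; lia.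
Qed.

Theorem theorem3 (R : realType) (n i : nat) (h1i : (1 <= i)%N) (hin : (i <= n)%N) :
  unimodular_simplex (n - i) (fixed_interval_polytope R n i).
Proof.
have dual (k : 'I_(n - i).+1) : exists f : 'rV[R]_n, lattice_point f /\
    forall l : nat, dot f (interval_vector R n l.+1 (l + i)) = (k == l :> nat)%:R.
  have kn : (k < n)%N by have := ltn_ord k; lia.
  by have [f fZ fE] := @interval_vector_dual R n i k h1i kn; exists f.
have [f fP] := choice dual.
(* Renumbering from 0: the interval of length [i] starting at [k.+1] ends at
   [k.+1 + i - 1 = k + i]. *)
pose a (k : 'I_(n - i).+1) := interval_vector R n k.+1 (k + i).
have -> : fixed_interval_polytope R n i = convex_hull (range a).
  congr convex_hull; apply/seteqP; split=> [_ [k /= kP <-]|_ [k _ <-]].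
    have kn : (k.-1 < (n - i).+1)%N by lia.
    by exists (Ordinal kn) => //; rewrite /a /=; congr interval_vector; lia.
  have kn := ltn_ord k.
  by exists k.+1 => /=; [|rewrite /a; congr interval_vector]; lia.
apply: (@unimodular_range _ _ _ _ f) => [k l|k j|k].
- by rewrite (fP k).2.
- by rewrite interval_vectorE; case: (_ && _).
- by have [] := fP k.
Qed.
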